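(* Let $|q|<1$, and let $z,c$ be complex numbers with $|zq|<1$ and $|c|\le 1$. Then \[ \sum_{n=1}^{\infty}\frac{(-1)^{n-1}z^nq^{n(n+1)/2}}{(1-cq^n)(zq;q)_n}=\frac{z}{c}\sum_{n=1}^{\infty}\frac{(zq/c;q)_{n-1}}{(zq;q)_n}(cq)^n. \]
   Context: For complex $A$ and $|q|<1$: $(A;q)_0=1$, $(A;q)_n=\prod_{j=0}^{n-1}(1-Aq^j)$ for $n\ge1$. *)

(* Defs.v *)
From Stdlib Require Import Reals.
From Coquelicot Require Import Coquelicot.

Open Scope C_scope.

Fixpoint qpoch (A q : C) (n : nat) : C :=
  match n with
  | O => 1
  | S m => qpoch A q m * (1 - A * q ^ m)
  end.

(* [is_series] starts at index 0, hence the shift. *)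
Definition is_series_from1 (a : nat -> C) (s : C) : Prop :=
  is_series (fun k : nat => a (S k)) s.

(* Main.v *)
Require Import Defs.
From Stdlib Require Import Reals Lra Lia IndefiniteDescription.
From Coquelicot Require Import Coquelicot.

Open Scope C_scope.

(** Put [x = z q], [w K n = (x/c)_n (c q^(K+1))^n / (x)_(K+n+1)] and
    [T K = sum_n w K n].  The contiguous relation
    [w K n + x q^(K+1) w (K+1) n = (w K n - w K (n+1)) / (1 - c q^(K+1))]
    sums to [T K + x q^(K+1) T (K+1) = 1 / ((1 - c q^(K+1)) (x)_(K+1))].
    Multiplying by [a K = (-1)^K x^(K+1) q^(K(K+1)/2)] turns the left-hand
    series into the telescoping sum of [a K T K - a (K+1) T (K+1)].  The [T K]
    are uniformly bounded and [a K] tends to [0], so its value is [x T 0],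
    which is the right-hand side. *)

(** * Elementary estimates for moduli and products *)

Lemma one_minus_neq0 (a : C) : (Cmod a < 1)%R -> 1 - a <> 0.
Proof.
intros ha h.
assert (e : a = 1) by (replace a with (1 - (1 - a)) by ring; rewrite h; ring).
rewrite e, Cmod_1 in ha; lra.
Qed.

Lemma pow_le_1 (r : R) (n : nat) : (0 <= r < 1)%R -> (0 <= r ^ n <= 1)%R.
Proof.
intros hr; induction n as [|n IH]; simpl; nra.
Qed.

Lemma Cmod_mult_pow_le (a q : C) (n : nat) :
  (Cmod q < 1)%R -> (Cmod (a * q ^ n) <= Cmod a)%R.
Proof.
intros hq; rewrite Cmod_mult, Cmod_pow.
pose proof (Cmod_ge_0 a); pose proof (Cmod_ge_0 q).
pose proof (pow_le_1 (Cmod q) n ltac:(lra)); nra.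
Qed.

Lemma one_minus_mult_pow_S_neq0 (c q : C) (K : nat) :
  (Cmod q < 1)%R -> (Cmod c <= 1)%R -> 1 - c * q ^ S K <> 0.
Proof.
intros hq hc; apply one_minus_neq0.
rewrite Cpow_S; replace (c * (q * q ^ K)) with (q * c * q ^ K) by ring.
eapply Rle_lt_trans; [now apply Cmod_mult_pow_le|].
rewrite Cmod_mult; pose proof (Cmod_ge_0 q); nra.
Qed.

(** Each factor satisfies [1 + t <= exp t], and the exponents add up to a geometric sum. This serves
    both for [(x;q)_n] and for its reciprocal. *)
Lemma product_le_exp (u : nat -> R) (C r : R) :
  (0 <= r < 1)%R -> (0 <= C)%R -> (0 <= u 0%nat <= 1)%R ->
  (forall n, 0 <= u (S n) <= u n * (1 + C * r ^ n))%R ->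
  forall n, (u n <= exp (C / (1 - r)))%R.
Proof.
intros hr hC h0 hS n.
(* The induction needs the partial geometric sum in the exponent; the bound with the full sum is not
   inductive. *)
assert (h : (0 <= u n <= exp (C * (1 - r ^ n) / (1 - r)))%R).
{ induction n as [|n IH].
  - replace (C * (1 - r ^ 0) / (1 - r))%R with 0%R by (simpl; field; lra).
    rewrite exp_0; lra.
  - split; [apply hS|].
    replace (C * (1 - r ^ S n) / (1 - r))%R
      with (C * (1 - r ^ n) / (1 - r) + C * r ^ n)%R by (simpl; field; lra).
    rewrite exp_plus.
    eapply Rle_trans; [apply hS|].
    pose proof (pow_le_1 r n hr).
    apply Rmult_le_compat; [lra|nra|lra|apply exp_ineq1_le]. }
eapply Rle_trans; [apply h|].
assert (he : forall a b, (a <= b -> exp a <= exp b)%R).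
{ intros a b [hab|<-]; [left; now apply exp_increasing|lra]. }
apply he.
apply Rmult_le_compat_r; [left; apply Rinv_0_lt_compat; lra|].
pose proof (pow_le_1 r n hr); nra.
Qed.

(** * Bounds, uniform in [n], for q-shifted factorials and their reciprocals *)

Lemma qpoch_neq0 (x q : C) (n : nat) :
  (Cmod q < 1)%R -> (Cmod x < 1)%R -> qpoch x q n <> 0.
Proof.
intros hq hx; induction n as [|n IH]; simpl.
- apply C1_nz.
- apply Cmult_neq_0; [exact IH|].
  apply one_minus_neq0.
  pose proof (Cmod_mult_pow_le x q n hq); lra.
Qed.

Lemma qpoch_bounded (x q : C) (n : nat) : (Cmod q < 1)%R ->
  (Cmod (qpoch x q n) <= exp (Cmod x / (1 - Cmod q)))%R.
Proof.
intros hq.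
apply (product_le_exp (fun n => Cmod (qpoch x q n))).
- split; [apply Cmod_ge_0|exact hq].
- apply Cmod_ge_0.
- simpl; rewrite Cmod_1; lra.
- intros k; split; [apply Cmod_ge_0|].
  simpl; rewrite Cmod_mult.
  apply Rmult_le_compat_l; [apply Cmod_ge_0|].
  unfold Cminus; eapply Rle_trans; [apply Cmod_triangle|].
  rewrite Cmod_1, Cmod_opp, Cmod_mult, Cmod_pow; lra.
Qed.

(** With [a = |x|], one has [|1 - y| >= 1 - a t] and [(1 - a t)(1 - a + a t) = 1 - a + a^2 t (1 - t)
    >= 1 - a]. Taking [t = |q|^k] gives a reciprocal factor the form that [product_le_exp]
    expects. *)
Lemma Cmod_inv_one_minus_le (x y : C) (t : R) :
  (Cmod x < 1)%R -> (0 <= t <= 1)%R -> Cmod y = (Cmod x * t)%R ->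
  (Cmod (/ (1 - y)) <= 1 + Cmod x / (1 - Cmod x) * t)%R.
Proof.
intros hx ht hy.
pose proof (Cmod_ge_0 x).
assert (hxt : (0 <= Cmod x * t <= Cmod x)%R) by nra.
assert (hy1 : (1 - Cmod x * t <= Cmod (1 - y))%R).
{ pose proof (Cmod_triangle (1 - y) y) as h.
  replace (1 - y + y) with (RtoC 1) in h by ring.
  rewrite Cmod_1 in h; lra. }
rewrite Cmod_inv by (apply one_minus_neq0; lra).
apply Rle_trans with (/ (1 - Cmod x * t))%R; [apply Rinv_le_contravar; lra|].
apply Rmult_le_reg_l with (1 - Cmod x * t)%R; [lra|].
rewrite Rinv_r by lra.
apply Rmult_le_reg_l with (1 - Cmod x)%R; [lra|].
replace ((1 - Cmod x) *
  ((1 - Cmod x * t) * (1 + Cmod x / (1 - Cmod x) * t)))%R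
  with ((1 - Cmod x * t) * (1 - Cmod x + Cmod x * t))%R by (field; lra).
nra.
Qed.

Lemma qpoch_inv_bounded (x q : C) (n : nat) :
  (Cmod q < 1)%R -> (Cmod x < 1)%R ->
  (Cmod (/ qpoch x q n)
    <= exp (Cmod x / (1 - Cmod x) / (1 - Cmod q)))%R.
Proof.
intros hq hx.
pose proof (Cmod_ge_0 x); pose proof (Cmod_ge_0 q).
apply (product_le_exp (fun n => Cmod (/ qpoch x q n))).
- lra.
- apply Rmult_le_pos; [lra|left; apply Rinv_0_lt_compat; lra].
- simpl; replace (/ 1) with (RtoC 1) by (field; apply C1_nz).
  rewrite Cmod_1; lra.
- intros k; split; [apply Cmod_ge_0|].
  simpl.
  assert (h1 : 1 - x * q ^ k <> 0).
  { apply one_minus_neq0; pose proof (Cmod_mult_pow_le x q k hq); lra. }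
  replace (/ (qpoch x q k * (1 - x * q ^ k)))
    with (/ qpoch x q k * / (1 - x * q ^ k))
    by (field; split; [exact h1|apply qpoch_neq0; assumption]).
  rewrite Cmod_mult.
  apply Rmult_le_compat_l; [apply Cmod_ge_0|].
  apply Cmod_inv_one_minus_le; [exact hx|apply pow_le_1; lra|].
  now rewrite Cmod_mult, Cmod_pow.
Qed.

(** * Series dominated by a geometric one, and telescoping *)

Lemma ex_series_geom_bound (a : nat -> C) (M r : R) :
  (0 <= r < 1)%R -> (forall n, Cmod (a n) <= M * r ^ n)%R ->
  exists l : C, is_series a l.
Proof.
intros hr h.
apply (@ex_series_le C_AbsRing C_CompleteNormedModule a
         (fun n => M * r ^ n)%R).
- intros n; exact (h n).
- exists (M * / (1 - r))%R.
  apply (is_series_scal_l M (fun n => r ^ n)%R (/ (1 - r))%R).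
  apply is_series_geom; rewrite Rabs_pos_eq; lra.
Qed.

Lemma Cmod_series_geom_bound (a : nat -> C) (l : C) (M r : R) :
  (0 <= r < 1)%R -> (forall n, Cmod (a n) <= M * r ^ n)%R ->
  is_series a l -> (Cmod l <= M / (1 - r))%R.
Proof.
intros hr h hl.
assert (hM : (0 <= M)%R).
{ pose proof (h 0%nat) as h0; pose proof (Cmod_ge_0 (a 0%nat)).
  simpl in h0; lra. }
assert (hpart : forall n, (Cmod (sum_n a n) <= M / (1 - r))%R).
{ intros n.
  assert (hn : (Cmod (sum_n a n) <= M * (1 - r ^ S n) / (1 - r))%R).
  { induction n as [|n IH].
    - rewrite sum_O; eapply Rle_trans; [apply h|].
      right; simpl; field; lra.
    - rewrite sum_Sn; eapply Rle_trans; [apply Cmod_triangle|].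
      eapply Rle_trans; [apply Rplus_le_compat; [exact IH|apply h]|].
      right; simpl; field; lra. }
  eapply Rle_trans; [exact hn|].
  apply Rmult_le_compat_r; [left; apply Rinv_0_lt_compat; lra|].
  pose proof (pow_le_1 r (S n) hr); nra. }
(* The bound on partial sums passes to the limit by continuity of the norm. *)
apply (filterlim_le (F := eventually) (fun n => Cmod (sum_n a n))
         (fun _ => (M / (1 - r))%R) (Finite (Cmod l))
         (Finite (M / (1 - r))%R)).
- exists 0%nat; intros n _; apply hpart.
- apply (filterlim_comp _ _ _ (sum_n a) Cmod eventually (locally l)).
  + exact hl.
  + apply (@filterlim_norm C_AbsRing C_NormedModule l).
- apply filterlim_const.
Qed.

(** Partial sums are [b 0 - b (n+1)], and the last term vanishes in the limit. It is applied in [n]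
    to the terms [w K n], then in [K] to [a K T K]. *)
Lemma is_series_telescope_geom (b : nat -> C) (M r : R) :
  (0 <= r < 1)%R -> (forall n, Cmod (b n) <= M * r ^ n)%R ->
  is_series (fun n => b n - b (S n)) (b 0%nat).
Proof.
intros hr h.
assert (hsum : forall n,
  sum_n (fun n => b n - b (S n)) n = b 0%nat - b (S n)).
{ induction n as [|n IH].
  - now rewrite sum_O.
  - rewrite sum_Sn, IH.
    change (b 0%nat - b (S n) + (b (S n) - b (S (S n))) =
            b 0%nat - b (S (S n)) :> C); ring. }
apply (@filterlim_locally_ball_norm C_AbsRing nat C_NormedModule
         eventually _ _ _).
intros eps.
assert (hlim : is_lim_seq (fun n => M * r ^ n)%R 0).
{ replace (Finite 0) with (Rbar_mult (Finite M) (Finite 0))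
    by (change (Finite (M * 0)%R = Finite 0); now rewrite Rmult_0_r).
  apply is_lim_seq_scal_l, is_lim_seq_geom; rewrite Rabs_pos_eq; lra. }
apply is_lim_seq_spec in hlim.
destruct (hlim eps) as [N hN].
exists N; intros n hn.
unfold ball_norm; rewrite hsum.
change (Cmod (b 0%nat - b (S n) - b 0%nat) < eps)%R.
replace (b 0%nat - b (S n) - b 0%nat) with (- b (S n)) by ring.
rewrite Cmod_opp.
eapply Rle_lt_trans; [apply h|].
specialize (hN (S n) ltac:(lia)).
rewrite Rminus_0_r in hN.
eapply Rle_lt_trans; [apply Rle_abs|exact hN].
Qed.

(** * The terms [w K n], the coefficients [a K] and their recurrences *)

Definition wterm (x c q : C) (K n : nat) : C :=
  qpoch (x / c) q n / qpoch x q (S (K + n)) * (c * q ^ S K) ^ n.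

(** One [M] works for all [K], because [|c q^(K+1)| <= |q|] and the factorial bounds ignore the
    index. Hence the sums [T K] are uniformly bounded. *)
Lemma wterm_bounded (x c q : C) :
  (Cmod q < 1)%R -> (Cmod x < 1)%R -> (Cmod c <= 1)%R ->
  exists M, forall K n, (Cmod (wterm x c q K n) <= M * Cmod q ^ n)%R.
Proof.
intros hq hx hc.
set (A := exp (Cmod (x / c) / (1 - Cmod q))).
set (B := exp (Cmod x / (1 - Cmod x) / (1 - Cmod q))).
exists (A * B)%R.
intros K n; unfold wterm, Cdiv.
rewrite !Cmod_mult, Cmod_pow.
apply Rmult_le_compat;
  [apply Rmult_le_pos; apply Cmod_ge_0|apply pow_le, Cmod_ge_0| |].
- apply Rmult_le_compat; try apply Cmod_ge_0.
  + now apply qpoch_bounded.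
  + now apply qpoch_inv_bounded.
- apply pow_incr; split; [apply Cmod_ge_0|].
  replace (c * q ^ S K) with ((c * q) * q ^ K) by (rewrite Cpow_S; ring).
  eapply Rle_trans; [now apply Cmod_mult_pow_le|].
  rewrite Cmod_mult; pose proof (Cmod_ge_0 q); nra.
Qed.

(** Both sides equal [w K n / (1 - x q^(K+n+1))]: on the right, the terms in [x] cancel and leave
    the factor [1 - c q^(K+1)]. *)
Lemma wterm_contiguous (x c q : C) (K n : nat) :
  (Cmod q < 1)%R -> (Cmod x < 1)%R -> (Cmod c <= 1)%R -> c <> 0 ->
  wterm x c q K n + x * q ^ S K * wterm x c q (S K) n =
  (wterm x c q K n - wterm x c q K (S n)) / (1 - c * q ^ S K).
Proof.
intros hq hx hc hc0.
pose proof (one_minus_mult_pow_S_neq0 c q K hq hc) as h1.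
assert (h2 : 1 - x * q ^ S (K + n) <> 0).
{ apply one_minus_neq0.
  eapply Rle_lt_trans; [now apply Cmod_mult_pow_le|exact hx]. }
pose proof (qpoch_neq0 x q (S (K + n)) hq hx) as h3.
unfold wterm.
replace (S (S K + n)) with (S (S (K + n))) by lia.
replace (S (K + S n)) with (S (S (K + n))) by lia.
change (qpoch x q (S (S (K + n))))
  with (qpoch x q (S (K + n)) * (1 - x * q ^ S (K + n))).
change (qpoch (x / c) q (S n)) with (qpoch (x / c) q n * (1 - x / c * q ^ n)).
assert (e1 : (c * q ^ S (S K)) ^ n = (c * q ^ S K) ^ n * q ^ n).
{ rewrite <- Cpow_mult_l; f_equal; rewrite (Cpow_S q (S K)); ring. }
assert (e2 : q ^ S (K + n) = q ^ S K * q ^ n)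
  by (rewrite <- Cpow_add_r; reflexivity).
rewrite e1, (Cpow_S (c * q ^ S K) n).
rewrite e2 in *.
field; repeat split; assumption.
Qed.

(* The coefficient [(-1)^K x^(K+1) q^(K(K+1)/2)] at [x = z q], in the shape of
   the [n = K + 1] term of the left-hand series. *)
Definition acoef (z q : C) (K : nat) : C :=
  (- 1) ^ K * z ^ S K * q ^ (S K * (S K + 1) / 2).

Lemma acoef_S (z q : C) (K : nat) :
  acoef z q (S K) = - (z * q) * q ^ S K * acoef z q K.
Proof.
unfold acoef.
(* The numerator grows by a multiple of 2, so integer division raises the exponent of [q] by exactly
   [K + 2]. *)
replace (S (S K) * (S (S K) + 1))%nat
  with (S K * (S K + 1) + S (S K) * 2)%nat by lia.
rewrite Nat.div_add by lia.
rewrite Cpow_add_r, !Cpow_S; ring.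
Qed.

(** The ratio is [|z|] times a power of [q], at most [|z q|] in modulus. The rate is [|z q|] since
    [|z|] itself may exceed 1. *)
Lemma acoef_bound (z q : C) (K : nat) : (Cmod q < 1)%R ->
  (Cmod (acoef z q K) <= Cmod (z * q) * Cmod (z * q) ^ K)%R.
Proof.
intros hq; induction K as [|K IH].
- right; unfold acoef; simpl.
  replace (1 * (z * 1) * (q * 1)) with (z * q) by ring; ring.
- rewrite acoef_S, Cmod_mult; simpl pow.
  replace (Cmod (z * q) * (Cmod (z * q) * Cmod (z * q) ^ K))%R
    with (Cmod (- (z * q)) * (Cmod (z * q) * Cmod (z * q) ^ K))%R
    by (rewrite Cmod_opp; ring).
  apply Rmult_le_compat; try apply Cmod_ge_0; [|exact IH].
  now apply Cmod_mult_pow_le.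
Qed.

Lemma wterm_sum_contiguous (x c q : C) (K : nat) (T0 T1 : C) :
  (Cmod q < 1)%R -> (Cmod x < 1)%R -> (Cmod c <= 1)%R -> c <> 0 ->
  is_series (wterm x c q K) T0 -> is_series (wterm x c q (S K)) T1 ->
  T0 + x * q ^ S K * T1 = / ((1 - c * q ^ S K) * qpoch x q (S K)).
Proof.
intros hq hx hc hc0 h0 h1.
pose proof (one_minus_mult_pow_S_neq0 c q K hq hc) as h2.
destruct (wterm_bounded x c q hq hx hc) as [M hM].
assert (hr : (0 <= Cmod q < 1)%R) by (split; [apply Cmod_ge_0|exact hq]).
pose proof (is_series_telescope_geom (wterm x c q K) M (Cmod q) hr (hM K))
  as ht.
apply (@is_series_scal C_AbsRing C_NormedModule (/ (1 - c * q ^ S K))) in ht.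
apply (@is_series_scal C_AbsRing C_NormedModule (x * q ^ S K)) in h1.
pose proof (is_series_plus _ _ _ _ h0 h1) as hs.
apply (is_series_ext _ (fun n => wterm x c q K n
  + x * q ^ S K * wterm x c q (S K) n)) in ht.
2: { intros n; rewrite wterm_contiguous by assumption.
    change (/ (1 - c * q ^ S K) * (wterm x c q K n - wterm x c q K (S n)) =
            (wterm x c q K n - wterm x c q K (S n)) / (1 - c * q ^ S K) :> C).
    unfold Cdiv; ring. }
(* One series is summed twice: termwise as [T0 + x q^(K+1) T1], and by telescoping down to its
   initial term [w K 0 = 1 / (x)_(K+1)]. Limits are unique. *)
replace (/ ((1 - c * q ^ S K) * qpoch x q (S K)))
  with (/ (1 - c * q ^ S K) * wterm x c q K 0).
- exact (filterlim_locally_unique _ _ _ hs ht).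
- unfold wterm; rewrite Nat.add_0_r.
  pose proof (qpoch_neq0 x q (S K) hq hx).
  replace (qpoch (x / c) q 0) with (RtoC 1) by reflexivity.
  replace ((c * q ^ S K) ^ 0) with (RtoC 1) by reflexivity.
  field; split; assumption.
Qed.

Theorem theorem2p2 (q z c : C)
    (hq : (Cmod q < 1)%R) (hzq : (Cmod (z * q) < 1)%R)
    (hc : (Cmod c <= 1)%R) (hc0 : c <> 0) :
  exists SL SR : C,
    is_series_from1
      (fun n : nat =>
         (- 1) ^ (n - 1) * z ^ n * q ^ (n * (n + 1) / 2) /
         ((1 - c * q ^ n) * qpoch (z * q) q n)) SL /\
    is_series_from1
      (fun n : nat =>
         qpoch (z * q / c) q (n - 1) / qpoch (z * q) q n * (c * q) ^ n) SR /\
    SL = z / c * SR.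
Proof.
destruct (wterm_bounded (z * q) c q hq hzq hc) as [M hM].
assert (hr : (0 <= Cmod q < 1)%R) by (split; [apply Cmod_ge_0|exact hq]).
destruct (functional_choice
  (fun K l => is_series (wterm (z * q) c q K) l)
  (fun K => ex_series_geom_bound _ M _ hr (hM K))) as [T hT].
exists (z * q * T 0%nat), (c * q * T 0%nat); split; [|split].
- unfold is_series_from1.
  replace (z * q * T 0%nat) with (acoef z q 0 * T 0%nat)
    by (unfold acoef; simpl; ring).
  apply (is_series_ext
    (fun K => acoef z q K * T K - acoef z q (S K) * T (S K))).
  + intros K.
    replace (S K - 1)%nat with K by lia.
    fold (acoef z q K); unfold Cdiv.
    (* Used backwards, the summed relation removes the denominator; then [a K x q^(K+1) = - a (K+1)]
       makes the term telescope. *)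
    rewrite <- (wterm_sum_contiguous (z * q) c q K (T K) (T (S K))) by auto.
    rewrite acoef_S.
    match goal with |- ?a = ?b => change (a = b :> C) end; ring.
  + apply (is_series_telescope_geom (fun K => acoef z q K * T K)
      (Cmod (z * q) * (M / (1 - Cmod q))) (Cmod (z * q))).
    * split; [apply Cmod_ge_0|exact hzq].
    * intros K; rewrite Cmod_mult.
      replace (Cmod (z * q) * (M / (1 - Cmod q)) * Cmod (z * q) ^ K)%R
        with (Cmod (z * q) * Cmod (z * q) ^ K * (M / (1 - Cmod q)))%R by ring.
      apply Rmult_le_compat; try apply Cmod_ge_0.
      -- now apply acoef_bound.
      -- exact (Cmod_series_geom_bound _ _ _ _ hr (hM K) (hT K)).
- unfold is_series_from1.
  (* The right-hand term of index [n + 1] carries [(c q)^(n+1)], one factor [c q] more than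
     [w 0 n]. *)
  apply (is_series_ext (fun n => c * q * wterm (z * q) c q 0 n)).
  + intros n; unfold wterm.
    replace (S n - 1)%nat with n by lia.
    change (0 + n)%nat with n.
    rewrite (Cpow_S (c * q)), Cpow_1_r; unfold Cdiv.
    match goal with |- ?a = ?b => change (a = b :> C) end; ring.
  + exact (@is_series_scal C_AbsRing C_NormedModule (c * q) _ _ (hT 0%nat)).
- field; exact hc0.
Qed.
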